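(* Let $\delta=r\Delta x\in(0,1)$ with $r\in\mathbb{N}$, $\Delta x=1/N$, and $T=N_T\cdot\Delta t$. Suppose that, for $i\in I=I_\Omega\cup I_B$ and $n=0,1,\dots,N_T-1$, $\{u_i^n\}$ solves the discrete QNL diffusion equation $$\begin{cases}\dfrac{u_i^{n+1}-u_i^n}{\Delta t}=\mathcal{L}^{qnl}_{\delta,\Delta x}u_i^n+f_i^n, & i\in I_\Omega,\ N_T>n\ge0,\\ u_i^0=g_i^0, & i\in I\ \text{(initial condition)},\\ u_i^n=q_i^n, & i\in I_B,\ n\ge0\ \text{(boundary condition)}.\end{cases}$$ Then, given that $f_i^n\le0$ for all $i\in I_\Omega$ and all $n\ge0$, and that $\frac{\Delta t}{\Delta x^2}\le\frac14$, $u_i^n$ satisfies the discrete maximum principle $$u_i^n\le\max\big\{\,g_i^0|_{i\in I},\ \ q_i^n|_{i\in I_B,\,n\ge0}\big\},$$ i.e. for every $i\in I$ and $n=0,\dots,N_T-1$, $u_i^n$ is at most the maximum of all the initial values $g_k^0$, $k\in I$, and all the boundary values $q_k^m$, $k\in I_B$, $m\ge0$.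
   Context: Kernel: $\gamma_\delta(s)=\gamma_\delta(|s|)=\frac{1}{\delta^3}\gamma\left(\frac{|s|}{\delta}\right)$, where $\gamma$ is nonnegative and nonincreasing on $(0,1)$, $\mathrm{supp}(\gamma)\subset[0,1]$, normalized so that $\int_0^\delta s^2\gamma_\delta(s)\,ds=1$. Grid: $x_i=-1+i\Delta x$, $\Delta x=1/N$, $\delta=r\Delta x$ with $r\in\mathbb{N}$, $\Delta t=T/N_T$. Time levels are those in $[0,T]$, i.e. $0\le n\le N_T$. Index sets: interior $I_\Omega=\{1,\dots,2N-1\}$, nonlocal boundary layer $I_{\Omega_n}=\{-(r-1),\dots,0\}$, local boundary $I_{\Omega_c}=\{2N\}$; $I_B=I_{\Omega_n}\cup I_{\Omega_c}$ and $I=I_\Omega\cup I_B$. Discrete quasi-nonlocal (QNL) operator, for $i\in I_\Omega$: If $x_i\le 0$ (i.e. $i\in\{1,\dots,N\}$), $$\mathcal{L}^{qnl}_{\delta,\Delta x}u_i^n=\sum_{j=1}^r\frac{u_{i+j}^n-2u_i^n+u_{i-j}^n}{(j\Delta x)^2}\int_{(j-1)\Delta x}^{j\Delta x}s^2\gamma_\delta(s)\,ds.$$ If $x_i\in(0,\delta]$ (i.e. $i\in\{N+1,\dots,N+r\}$), $$\mathcal{L}^{qnl}_{\delta,\Delta x}u_i^n=\sum_{j=\frac{x_i}{\Delta x}+1}^{r}\frac{u_{i+j-1}^n-2u_i^n+u_{i-j+1}^n}{2(j-1)\Delta x}\int_{(j-1)\Delta x}^{j\Delta x}s\gamma_\delta(s)ds-\sum_{j=\frac{x_i}{\Delta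 x}+1}^{r}\frac{u_{i+j-1}^n-u_{i-j+1}^n}{2(j-1)\Delta x}\int_{(j-1)\Delta x}^{j\Delta x}s\gamma_\delta(s)ds$$ $$\qquad+\Big(\int_{x_i}^\delta s\gamma_\delta(s)ds\Big)\frac{u_{i+1}^n-u_i^n}{\Delta x}+\Big(\int_0^{x_i}s^2\gamma_\delta(s)ds+x_i\int_{x_i}^\delta s\gamma_\delta(s)ds\Big)\frac{u_{i+1}^n-2u_i^n+u_{i-1}^n}{(\Delta x)^2}$$ (empty sums are zero; the terms in $u_{i+j-1}^n$ cancel between the two sums, so no value outside the grid is needed). If $x_i\in(\delta,1)$ (i.e. $i\in\{N+r+1,\dots,2N-1\}$), $$\mathcal{L}^{qnl}_{\delta,\Delta x}u_i^n=\frac{u_{i+1}^n-2u_i^n+u_{i-1}^n}{(\Delta x)^2}.$$ *)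

(* Defs.v *)
From HB Require Import structures.
From mathcomp Require Import all_boot all_order all_algebra.
From mathcomp Require Import all_classical all_reals all_analysis.
Set Implicit Arguments.
Unset Strict Implicit.
Unset Printing Implicit Defensive.
Import Order.TTheory GRing.Theory Num.Theory.
Import numFieldNormedType.Exports.
Local Open Scope classical_set_scope.
Local Open Scope ring_scope.

Definition rescaled_kernel (R : realType) (gamma : R -> R) (delta s : R) : R :=
  (delta ^+ 3)^-1 * gamma (`|s| / delta).

(** [kernel_moment gamma delta p a b] is the integral of s^p gamma_delta(s)
    over [a, b]. *)
Definition kernel_moment (R : realType) (gamma : R -> R) (delta : R)
    (p : nat) (a b : R) : R :=
  \int[lebesgue_measure]_(s in `[a, b]) (s ^+ p * rescaled_kernel gamma delta s).

Definition dx (R : realType) (N : nat) : R := 1 / N%:R.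
Definition horizon (R : realType) (N r : nat) : R := r%:R * dx R N.
Definition gridpt (R : realType) (N : nat) (i : int) : R := -1 + i%:~R * dx R N.

(** {1, ..., 2N-1}, {-(r-1), ..., 0} and {2N}. *)
Definition I_Omega (N : nat) : seq int := [seq Posz k | k <- iota 1 (2 * N - 1)].
Definition I_Omega_n (r : nat) : seq int := [seq - Posz k | k <- iota 0 r].
Definition I_Omega_c (N : nat) : seq int := [:: Posz (2 * N)].
Definition I_B (N r : nat) : seq int := I_Omega_n r ++ I_Omega_c N.
Definition I_all (N r : nat) : seq int := I_Omega N ++ I_B N r.

(** Grid functions are total on [int].  For x_i in (0, delta] the two sums may
    mention indices beyond 2N, but the terms in [v (i + j - 1)] cancel, so for
    i in [I_Omega N] the values of [v] outside [I_all N r] do not matter.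
    In that case x_i / dx is the integer i - N, so the filter
    [x / h + 1 <= j%:R] makes j run from x_i / dx + 1 to r. *)
Definition Lqnl (R : realType) (gamma : R -> R) (N r : nat)
    (v : int -> R) (i : int) : R :=
  let h := dx R N in
  let delta := horizon R N r in
  let x := gridpt R N i in
  let M := kernel_moment gamma delta in
  if x <= 0 then
    \sum_(1 <= j < r.+1)
      (v (i + j%:Z) - 2 * v i + v (i - j%:Z)) / (j%:R * h) ^+ 2
      * M 2%N (j.-1%:R * h) (j%:R * h)
  else if x <= delta then
    \sum_(1 <= j < r.+1 | x / h + 1 <= j%:R)
      (v (i + j%:Z - 1) - 2 * v i + v (i - j%:Z + 1)) / (2 * (j.-1%:R * h))
      * M 1%N (j.-1%:R * h) (j%:R * h)
    - \sum_(1 <= j < r.+1 | x / h + 1 <= j%:R)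
      (v (i + j%:Z - 1) - v (i - j%:Z + 1)) / (2 * (j.-1%:R * h))
      * M 1%N (j.-1%:R * h) (j%:R * h)
    + M 1%N x delta * ((v (i + 1) - v i) / h)
    + (M 2%N 0 x + x * M 1%N x delta)
      * ((v (i + 1) - 2 * v i + v (i - 1)) / h ^+ 2)
  else
    (v (i + 1) - 2 * v i + v (i - 1)) / h ^+ 2.

(** The maximum of the values g_k, k in I, and q_k^m, k in I_B, 0 <= m <= N_T.
    The seed of the iterated [Num.max] is g at the index 2N, which lies in I,
    so it is itself one of these values. *)
Definition data_max (R : realType) (N r NT : nat)
    (g : int -> R) (q : nat -> int -> R) : R :=
  \big[Num.max/g (Posz (2 * N))]_(z <- [seq g k | k <- I_all N r] ++
      [seq q m k | m <- iota 0 NT.+1, k <- I_B N r]) z.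

(* Main.v *)
Require Import Defs.
From HB Require Import structures.
From mathcomp Require Import all_boot all_order all_algebra.
From mathcomp Require Import all_classical all_reals all_analysis.
From mathcomp Require Import measurable_realfun.
From mathcomp Require Import ring lra zify.
Set Implicit Arguments.
Unset Strict Implicit.
Unset Printing Implicit Defensive.
Import Order.TTheory GRing.Theory Num.Theory.
Import numFieldNormedType.Exports.
Local Open Scope classical_set_scope.
Local Open Scope ring_scope.

(** Write h for the mesh size and delta = r h for the horizon.  If every grid
    value of v is at most B, then at each interior index

      L v i <= (4 / h^2) (B - v i),

    and this one-sided bound is all that the maximum principle needs: with
    dt <= h^2 / 4 and f <= 0, an explicit Euler step gives
    u (n+1) i <= u n i + (B - u n i) = B, where B is the maximum of the data.

    The bound holds because L v i, after the cancellation of the values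
    v (i + j - 1) in the transition region, is a combination of differences
    v k - v i over grid indices k with nonnegative weights, and the weights
    add up to at most 4 / h^2.  Each difference is at most B - v i.  For the
    weights, let M_p(a, b) be the p-th moment of the kernel over [a, b].
    - For x_i <= 0 the weights add up to the sum over the cells of
      2 M_2(cell) / (j h)^2, at most 2 M_2(0, delta) / h^2 = 2 / h^2.
    - For x = x_i in (0, delta], first moments are turned into second moments
      by a M_1(a, b) <= M_2(a, b) (because a <= s on [a, b]).  Multiplied by
      h^2, and since h <= x, the leftward sum contributes at most
      M_2(x, delta), the one-sided difference at most h M_1(x, delta)
      <= M_2(x, delta), and the second difference at most
      2 (M_2(0, x) + M_2(x, delta)) = 2.  The total is at most 4.
    - For x_i > delta the weights of the standard second difference add up to
      2 / h^2.

    The analytic input is that second moments are nonnegative, finite and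
    additive over adjacent intervals.  First moments may diverge at 0, and
    they are only used on intervals that start at a positive point. *)

(** * Moments of the rescaled kernel *)

(** Superlevel sets of f inside D are intervals.  Monotonicity is only required
    on D, as a kernel that blows up at 0 has no monotone extension to the whole
    line. *)
Lemma nonincreasing_in_measurable (R : realType) (D : set R) (f : R -> R) :
  is_interval D -> (forall s t, D s -> D t -> s <= t -> f t <= f s) ->
  measurable_fun D f.
Proof.
move=> iD f_ni.
apply: (measurability (@RGenCInfty.G R)) => [|/= _ [_] [c] -> <-].
  exact: RGenCInfty.measurableE.
apply: is_interval_measurable => s t /= [Ds fs] [Dt ft] y syt.
have Dy : D y by exact: (iD s t).
split => //; move: ft; rewrite !in_itv/= !andbT => ft.
by apply: (le_trans ft); apply: f_ni => //; case/andP: syt.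
Qed.

Section moments.
Variables (R : realType) (gamma : R -> R) (delta : R).
Hypothesis delta_gt0 : 0 < delta.
Hypothesis gamma_ge0 : forall s, 0 < s -> s < 1 -> 0 <= gamma s.
Hypothesis gamma_nonincreasing :
  forall s t, 0 < s -> s <= t -> t < 1 -> gamma t <= gamma s.
Hypothesis gamma_normalized : kernel_moment gamma delta 2 0 delta = 1.

Notation mu := (@lebesgue_measure R).
Notation M := (kernel_moment gamma delta).
Notation w p := (fun s : R => s ^+ p * rescaled_kernel gamma delta s).

Lemma rescaled_kernel_ge0 s :
  0 < s -> s < delta -> 0 <= rescaled_kernel gamma delta s.
Proof.
move=> s0 sd; apply: mulr_ge0; first by rewrite invr_ge0 exprn_ge0// ltW.
by rewrite gtr0_norm// gamma_ge0 ?divr_gt0// ltr_pdivrMr ?mul1r.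
Qed.

Lemma rescaled_kernel_nonincreasing s t : 0 < s -> s <= t -> t < delta ->
  rescaled_kernel gamma delta t <= rescaled_kernel gamma delta s.
Proof.
move=> s0 st td; have t0 := lt_le_trans s0 st.
apply: ler_wpM2l; first by rewrite invr_ge0 exprn_ge0// ltW.
rewrite !gtr0_norm// gamma_nonincreasing ?divr_gt0//.
  by rewrite ler_pM2r ?invr_gt0.
by rewrite ltr_pdivrMr ?mul1r.
Qed.

Lemma measurable_weighted_kernel p : measurable_fun `[0, delta] (w p).
Proof.
apply: (@measurable_fun_itv_cc _ _ _ false true); apply: measurable_funM.
  exact: measurable_funX.
apply: nonincreasing_in_measurable; first exact: interval_is_interval.
move=> s t /=; rewrite !in_itv/= => /andP[s0 _] /andP[_ td] st.
exact: rescaled_kernel_nonincreasing.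
Qed.

(** The sign and monotonicity of gamma are known on the open interval (0, 1)
    only; endpoints have measure zero, so moments can be computed without
    them. *)
Lemma kernel_momentoo p a b : 0 <= a -> b <= delta ->
  M p a b = \int[mu]_(s in `]a, b[) w p s.
Proof.
move=> a0 bd; rewrite /kernel_moment /Rintegral integral_itv_bndoo//.
apply/measurable_EFinP; apply: measurable_funS (measurable_weighted_kernel p) => //.
by apply: subset_itv; rewrite bnd_simp.
Qed.

Lemma kernel_moment_ge0 p a b : 0 <= a -> b <= delta -> 0 <= M p a b.
Proof.
move=> a0 bd; rewrite kernel_momentoo//; apply: Rintegral_ge0 => s /=.
rewrite in_itv/= => /andP[sa sb].
have s0 : 0 < s by exact: le_lt_trans sa.
apply: mulr_ge0; first exact/exprn_ge0/ltW.
exact/rescaled_kernel_ge0/(lt_le_trans sb).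
Qed.

(** The real-valued integral of a function with infinite integral is 0 by
    convention, so the normalization to 1 forces the second moment to be
    finite. *)
Lemma integrable_second_moment : mu.-integrable `[0, delta] (EFin \o w 2).
Proof.
have mw := measurable_weighted_kernel 2.
have moo : measurable_fun `]0, delta[ (w 2).
  by apply: measurable_funS mw => //; apply: subset_itv; rewrite bnd_simp.
apply/integrableP; split; first exact/measurable_EFinP.
rewrite integral_itv_bndoo; last first.
  by apply: measurableT_comp => //; exact/measurable_EFinP.
rewrite (_ : (\int[mu]_(s in `]0%R, delta[) _)%E =
             (\int[mu]_(s in `]0%R, delta[) (w 2 s)%:E)%E); last first.
  apply: eq_integral => s; rewrite inE/= in_itv/= => /andP[s0 sd].
  by rewrite ger0_norm// mulr_ge0 ?rescaled_kernel_ge0// exprn_ge0// ltW.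
move: gamma_normalized; rewrite kernel_momentoo// /Rintegral.
case: (\int[mu]_(s in `]0%R, delta[) (w 2 s)%:E)%E => [x _|/=|/=].
- exact: ltry.
- by move=> /esym/eqP; rewrite oner_eq0.
- by move=> /esym/eqP; rewrite oner_eq0.
Qed.

Lemma second_moment_split b c : 0 <= b -> b <= c -> c <= delta ->
  M 2 b c = M 2 0 c - M 2 0 b.
Proof.
move=> b0 bc cd; rewrite {2 3}/kernel_moment Rintegral_itvB ?bnd_simp//.
  rewrite kernel_momentoo//; apply: Rintegral_itv_bndo_bndc.
  apply: integrableS integrable_second_moment => //.
  by apply: subset_itv; rewrite bnd_simp//.
apply: integrableS integrable_second_moment => //.
by apply: subset_itv; rewrite bnd_simp//.
Qed.

(** Pointwise a s <= s^2 on [a, b].  Positivity of a makes the first moment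
    finite, by domination by the second one. *)
Lemma first_moment_le_second a b :
  0 < a -> b <= delta -> a * M 1 a b <= M 2 a b.
Proof.
move=> a0 bd.
have sub : `]a, b[ `<=` `[0, delta].
  by apply: subset_itv; rewrite bnd_simp// ltW.
have i2 : mu.-integrable `]a, b[ (EFin \o w 2).
  exact: integrableS integrable_second_moment.
have m1 : measurable_fun `]a, b[ (w 1).
  by apply: measurable_funS (measurable_weighted_kernel 1).
have dom s : `]a, b[%classic s -> 0 <= w 1 s /\ a * w 1 s <= w 2 s.
  rewrite /= in_itv/= => /andP[sa sb]; have s0 := lt_trans a0 sa.
  have k0 : 0 <= rescaled_kernel gamma delta s.
    by rewrite rescaled_kernel_ge0//; exact: lt_le_trans sb _.
  split; first by rewrite mulr_ge0// exprn_ge0// ltW.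
  by rewrite expr1 expr2 mulrA ler_wpM2r// ler_wpM2r// ltW.
have ia1 : mu.-integrable `]a, b[ (EFin \o (fun s => a * w 1 s)).
  apply: le_integrable i2 => //.
    by apply/measurable_EFinP; exact: measurable_funM.
  move=> s /dom[w0 le]; rewrite /= lee_fin !ger0_norm//.
    by rewrite (le_trans _ le)// mulr_ge0// ltW.
  by rewrite mulr_ge0// ltW.
have i1 : mu.-integrable `]a, b[ (EFin \o w 1).
  rewrite (_ : w 1 = fun s => a^-1 * (a * w 1 s)); last first.
    by apply/funext => s; rewrite mulKf// gt_eqF.
  exact: (integrableZl _ a^-1 ia1).
rewrite !kernel_momentoo ?(ltW a0)// -RintegralZl//.
by apply: le_Rintegral => // s /dom[].
Qed.

End moments.

(** * The grid and the discrete operator *)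

Lemma mem_I_Omega (N : nat) (k : int) :
  (k \in I_Omega N) = (0 < k < Posz (2 * N)).
Proof.
apply/mapP/andP => [[m]|[k0 k2N]].
  by rewrite mem_iota => mN ->; split; lia.
by exists `|k|%N; [rewrite mem_iota|]; lia.
Qed.

Lemma mem_I_all (N r : nat) (k : int) : (0 < N)%N -> (0 < r)%N ->
  (k \in I_all N r) = (- Posz r < k <= Posz (2 * N)).
Proof.
move=> N0 r0; rewrite /I_all /I_B !mem_cat mem_I_Omega mem_seq1.
have -> : (k \in I_Omega_n r) = (- Posz r < k <= 0).
  apply/mapP/andP => [[m]|[kr k0]].
    by rewrite mem_iota => mr ->; split; lia.
  by exists `|k|%N; [rewrite mem_iota|]; lia.
by apply/idP/idP; lia.
Qed.

Section operator_bound.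
Variables (R : realType) (gamma : R -> R) (N r : nat).
Hypothesis N_gt0 : (0 < N)%N.
Hypothesis delta_gt0 : 0 < horizon R N r.
Hypothesis delta_lt1 : horizon R N r < 1.
Hypothesis gamma_ge0 : forall s, 0 < s -> s < 1 -> 0 <= gamma s.
Hypothesis gamma_nonincreasing :
  forall s t, 0 < s -> s <= t -> t < 1 -> gamma t <= gamma s.
Hypothesis gamma_normalized :
  kernel_moment gamma (horizon R N r) 2 0 (horizon R N r) = 1.

Notation h := (dx R N).
Notation delta := (horizon R N r).
Notation M := (kernel_moment gamma delta).

Lemma dx_gt0 : 0 < h.
Proof. by rewrite /dx divr_gt0 ?ltr0n. Qed.

Lemma gridptE (i : int) : gridpt R N i = (i - Posz N)%:~R * h.
Proof.
have N0 : N%:R != 0 :> R by rewrite pnatr_eq0 -lt0n.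
by rewrite /gridpt /dx rmorphB /=; field.
Qed.

Lemma radius_gt0 : (0 < r)%N.
Proof. by move: delta_gt0; rewrite /horizon pmulr_lgt0 ?dx_gt0// ltr0n. Qed.

Lemma radius_lt : (r < N)%N.
Proof.
move: delta_lt1; rewrite /horizon /dx mul1r ltr_pdivrMr ?ltr0n// mul1r.
by rewrite ltr_nat.
Qed.

Lemma cell_le (j : nat) : (j <= r)%N -> j%:R * h <= delta.
Proof. by move=> jr; rewrite /horizon ler_pM2r ?dx_gt0// ler_nat. Qed.

Lemma cell_ge0 (j : nat) : 0 <= j%:R * h.
Proof. by rewrite mulr_ge0// ltW// dx_gt0. Qed.

(** Telescoping: each cell contributes a difference of values of M_2(0, .). *)
Lemma second_moment_cells (k : nat) : (k <= r)%N ->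
  \sum_(k.+1 <= j < r.+1) M 2%N (j.-1%:R * h) (j%:R * h) = M 2%N (k%:R * h) delta.
Proof.
move=> kr; rewrite big_add1 /= big_nat.
under eq_bigr => j /andP[kj jr].
  rewrite second_moment_split ?cell_ge0 ?cell_le//; last first.
    by rewrite ler_pM2r ?dx_gt0// ler_nat.
  over.
rewrite -big_nat (telescope_sumr (fun j => M 2 0 (j%:R * h)))//.
by rewrite [RHS]second_moment_split ?cell_ge0 ?cell_le.
Qed.

Variables (B : R) (v : int -> R).
Hypothesis v_le : forall k, k \in I_all N r -> v k <= B.

(** Left of the interface each cell weight 2 M_2 / (j h)^2 is at most
    2 M_2 / h^2, and the cell moments add up to 1.  The stencil reaches
    i + r < 2 N because delta < 1. *)
Lemma Lqnl_nonlocal_le (i : int) : i \in I_Omega N -> gridpt R N i <= 0 ->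
  Lqnl gamma N r v i <= 4 / h ^+ 2 * (B - v i).
Proof.
move=> iO x0; have h0 := dx_gt0; have r0 := radius_gt0; have rN := radius_lt.
have [i0 i2N] : 0 < i /\ i < Posz (2 * N) by apply/andP; rewrite -mem_I_Omega.
have iN : i <= Posz N.
  by move: x0; rewrite gridptE pmulr_lle0// -[0]/(0%:~R) ler_int; lia.
have c0 : 0 <= B - v i by rewrite subr_ge0 v_le// mem_I_all//; lia.
rewrite /Lqnl x0.
apply: (@le_trans _ _ (\sum_(1 <= j < r.+1)
    2 / h ^+ 2 * (B - v i) * M 2%N (j.-1%:R * h) (j%:R * h))).
  rewrite big_nat [leRHS]big_nat; apply: ler_sum => j /andP[j1 jr].
  apply: ler_wpM2r.
    by apply: kernel_moment_ge0 => //; rewrite ?cell_ge0 ?cell_le.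
  have vp : v (i + Posz j) <= B by rewrite v_le// mem_I_all//; lia.
  have vm : v (i - Posz j) <= B by rewrite v_le// mem_I_all//; lia.
  have j1R : 1 <= j%:R :> R by rewrite ler1n.
  have jh0 : 0 < j%:R * h by rewrite mulr_gt0// ltr0n.
  rewrite ler_pdivrMr ?exprn_gt0//.
  apply: (@le_trans _ _ (2 * (B - v i))); first by lra.
  rewrite (_ : _ * _ * _ = 2 * (B - v i) * j%:R ^+ 2); last first.
    by field; rewrite gt_eqF.
  by rewrite ler_peMr ?mulr_ge0// exprn_ege1.
rewrite -mulr_sumr second_moment_cells// mul0r gamma_normalized mulr1.
by rewrite ler_wpM2r// ler_wpM2r ?invr_ge0 ?exprn_ge0 ?(ltW h0)// ler_nat.
Qed.

Lemma Lqnl_local_le (i : int) : i \in I_Omega N ->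
  (v (i + 1) - 2 * v i + v (i - 1)) / h ^+ 2 <= 2 / h ^+ 2 * (B - v i).
Proof.
move=> iO; have r0 := radius_gt0.
have [i0 i2N] : 0 < i /\ i < Posz (2 * N) by apply/andP; rewrite -mem_I_Omega.
rewrite mulrAC ler_pM2r ?invr_gt0 ?exprn_gt0 ?dx_gt0//.
have vp : v (i + 1) <= B by rewrite v_le// mem_I_all//; lia.
have vm : v (i - 1) <= B by rewrite v_le// mem_I_all//; lia.
by lra.
Qed.

(** In the transition region the two sums combine into differences towards the
    left only.  Everything is measured in second moments over (0, x) and
    (x, delta), whose sum is 1: with m2 = M_2(x, delta), the sum, the one-sided
    difference and the second difference have h^2-scaled weights at most m2,
    m2 and 2. *)
Lemma Lqnl_transition_le (i : int) : i \in I_Omega N ->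
  0 < gridpt R N i -> gridpt R N i <= delta ->
  Lqnl gamma N r v i <= 4 / h ^+ 2 * (B - v i).
Proof.
move=> iO x0 xd; have h0 := dx_gt0; have r0 := radius_gt0; have rN := radius_lt.
have [i0 i2N] : 0 < i /\ i < Posz (2 * N) by apply/andP; rewrite -mem_I_Omega.
have c0 : 0 <= B - v i by rewrite subr_ge0 v_le// mem_I_all//; lia.
rewrite /Lqnl (lt_geF x0) xd.
have vp : v (i + 1) <= B by rewrite v_le// mem_I_all//; lia.
(* In mesh units x_i is the integer k = i - N. *)
have [k ik] : exists k, i = Posz (N + k).
  move: x0; rewrite gridptE pmulr_lgt0// -[0]/(0%:~R) ltr_int => x0.
  by exists `|i - Posz N|%N; lia.
have v_left j : (0 < j)%N -> (j < r.+1)%N -> v (i - Posz j + 1) <= B.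
  by move=> j1 jr; rewrite v_le// mem_I_all//; lia.
have xk : gridpt R N i = k%:R * h.
  by rewrite gridptE ik -[k%:R]/((Posz k)%:~R); congr (_%:~R * _); lia.
have k0 : (0 < k)%N by move: x0; rewrite xk pmulr_lgt0// ltr0n.
have kr : (k <= r)%N by move: xd; rewrite xk /horizon ler_pM2r// ler_nat.
rewrite xk; set x := k%:R * h; set c := B - v i in c0 *.
have {}x0 : 0 < x by rewrite /x -xk.
have {}xd : x <= delta by rewrite /x -xk.
have hx : h <= x by rewrite /x ler_peMl ?(ltW h0)// ler1n.
set m1 := M 1%N x delta; set m2 := M 2%N x delta.
have m1_ge0 : 0 <= m1 by apply: kernel_moment_ge0; rewrite // ltW.
have m12 : x * m1 <= m2 by exact: first_moment_le_second.
have m2E : M 2%N 0 x = 1 - m2.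
  rewrite /m2 (@second_moment_split _ _ _ _ _ _ _ x)// ?ltW// gamma_normalized.
  by ring.
have m2c0 : 0 <= 1 - m2.
  by rewrite -m2E kernel_moment_ge0.
rewrite -sumrB m2E.
have sums : \sum_(1 <= j < r.+1 | x / h + 1 <= j%:R)
   ((v (i + Posz j - 1) - 2 * v i + v (i - Posz j + 1)) / (2 * (j.-1%:R * h))
      * M 1%N (j.-1%:R * h) (j%:R * h)
   - (v (i + Posz j - 1) - v (i - Posz j + 1)) / (2 * (j.-1%:R * h))
      * M 1%N (j.-1%:R * h) (j%:R * h)) <= c / h ^+ 2 * m2.
  rewrite /m2 -second_moment_cells// mulr_sumr.
  rewrite [leRHS](big_nat_widenl _ 1)//=.
  rewrite (eq_bigl (fun j => (k < j)%N)); last first.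
    by move=> j; rewrite /x mulfK ?gt_eqF// natr1 ler_nat.
  rewrite big_nat_cond [leRHS]big_nat_cond.
  apply: ler_sum => j /andP[/andP[j1 jr] kj].
  set y := j.-1%:R * h; set z := j%:R * h.
  have hy : h <= y by rewrite /y ler_peMl ?(ltW h0)// ler1n -ltnS prednK// (leq_ltn_trans k0).
  have y0 : 0 < y := lt_le_trans h0 hy.
  have zd : z <= delta by exact: cell_le.
  have vm := v_left _ j1 jr.
  have n0 : 0 <= M 1 y z by apply: kernel_moment_ge0; rewrite // ltW.
  have n12 : y * M 1 y z <= M 2 y z.
    by exact: first_moment_le_second.
  have n2 : 0 <= M 2 y z by apply: kernel_moment_ge0; rewrite // ltW.
  (* The values v (i + j - 1) cancel here; the weight M_1 / y is written as
     (y M_1) / y^2 so that it compares with M_2 / h^2. *)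
  rewrite (_ : _ - _ = (v (i - Posz j + 1) - v i) / y ^+ 2 * (y * M 1 y z));
    last by field; rewrite gt_eqF.
  apply: (@le_trans _ _ (c / y ^+ 2 * (y * M 1 y z))).
    apply: ler_wpM2r; first by rewrite mulr_ge0// ltW.
    by rewrite ler_wpM2r ?invr_ge0 ?exprn_ge0 ?(ltW y0)// lerB.
  apply: ler_pM => //; first by rewrite divr_ge0// exprn_ge0// ltW.
    by rewrite mulr_ge0// ltW.
  rewrite ler_wpM2l// lef_pV2 ?posrE ?exprn_gt0//.
  by rewrite lerXn2r ?nnegrE ?(ltW h0) ?(ltW y0).
have upwind : m1 * ((v (i + 1) - v i) / h) <= c / h ^+ 2 * m2.
  apply: (@le_trans _ _ (m1 * (c / h))).
    by rewrite ler_wpM2l// ler_wpM2r ?invr_ge0 ?(ltW h0)// lerB.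
  rewrite (_ : m1 * _ = c / h ^+ 2 * (h * m1)); last by field; rewrite gt_eqF.
  rewrite ler_wpM2l ?divr_ge0 ?exprn_ge0 ?(ltW h0)//.
  by apply: le_trans m12; rewrite ler_wpM2r.
have diffusive : (1 - m2 + x * m1) * ((v (i + 1) - 2 * v i + v (i - 1)) / h ^+ 2)
    <= 2 / h ^+ 2 * c.
  apply: (@le_trans _ _ ((1 - m2 + x * m1) * (2 / h ^+ 2 * c))).
    by rewrite ler_wpM2l ?Lqnl_local_le// addr_ge0// mulr_ge0// ltW.
  rewrite ler_piMl ?mulr_ge0 ?invr_ge0 ?exprn_ge0 ?(ltW h0)//.
  by lra.
have m2c : c / h ^+ 2 * m2 <= c / h ^+ 2.
  by rewrite ler_piMr ?divr_ge0 ?exprn_ge0 ?(ltW h0)//; lra.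
have -> : 4 / h ^+ 2 * c = c / h ^+ 2 + c / h ^+ 2 + 2 / h ^+ 2 * c.
  by field; rewrite gt_eqF.
apply: lerD => //; apply: lerD.
  exact: le_trans sums m2c.
exact: le_trans upwind m2c.
Qed.

Lemma Lqnl_le (i : int) : i \in I_Omega N ->
  Lqnl gamma N r v i <= 4 / h ^+ 2 * (B - v i).
Proof.
move=> iO; have [x0|x0] := leP (gridpt R N i) 0; first exact: Lqnl_nonlocal_le.
have [xd|xd] := leP (gridpt R N i) delta; first exact: Lqnl_transition_le.
rewrite /Lqnl (lt_geF x0) (lt_geF xd); apply: le_trans (Lqnl_local_le iO) _.
have iI : i \in I_all N r by rewrite /I_all mem_cat iO.
rewrite ler_wpM2r ?subr_ge0 ?v_le//.
by rewrite ler_wpM2r ?invr_ge0 ?exprn_ge0 ?(ltW dx_gt0)// ler_nat.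
Qed.

End operator_bound.

(** * The maximum principle *)

Lemma data_max_initial (R : realType) (N r NT : nat) (g : int -> R)
    (q : nat -> int -> R) (k : int) :
  k \in I_all N r -> g k <= data_max N r NT g q.
Proof.
by move=> kI; apply: le_bigmax_seq => //; rewrite mem_cat map_f.
Qed.

Lemma data_max_boundary (R : realType) (N r NT : nat) (g : int -> R)
    (q : nat -> int -> R) (m : nat) (k : int) :
  (m <= NT)%N -> k \in I_B N r -> q m k <= data_max N r NT g q.
Proof.
move=> mNT kB; apply: le_bigmax_seq => //; rewrite mem_cat; apply/orP; right.
by apply: allpairs_f => //; rewrite mem_iota.
Qed.

Theorem theorem4p2 (R : realType) (gamma : R -> R) (N r NT : nat) (T dt : R)
  (u : nat -> int -> R) (f : nat -> int -> R) (g : int -> R) (q : nat -> int -> R)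
  (N_gt0 : (0 < N)%N)
  (delta_gt0 : 0 < horizon R N r)
  (delta_lt1 : horizon R N r < 1)
  (gamma_ge0 : forall s, 0 < s -> s < 1 -> 0 <= gamma s)
  (gamma_nonincreasing : forall s t, 0 < s -> s <= t -> t < 1 -> gamma t <= gamma s)
  (gamma_supp : closure [set s | gamma s != 0] `<=` `[0, 1])
  (gamma_normalized :
    kernel_moment gamma (horizon R N r) 2 0 (horizon R N r) = 1)
  (T_gt0 : 0 < T)
  (NT_gt0 : (0 < NT)%N)
  (T_def : T = NT%:R * dt)
  (diffusion_eq : forall n i, (n < NT)%N -> i \in I_Omega N ->
    (u n.+1 i - u n i) / dt = Lqnl gamma N r (u n) i + f n i)
  (initial_cond : forall i, i \in I_all N r -> u 0%N i = g i)
  (boundary_cond : forall n i, (n <= NT)%N -> i \in I_B N r -> u n i = q n i)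
  (f_le0 : forall n i, (n <= NT)%N -> i \in I_Omega N -> f n i <= 0)
  (cfl : dt / dx R N ^+ 2 <= 1 / 4) :
  forall n i, (n < NT)%N -> i \in I_all N r -> u n i <= data_max N r NT g q.
Proof.
have dt_gt0 : 0 < dt by move: T_gt0; rewrite T_def pmulr_rgt0 ?ltr0n.
elim=> [|n IHn] i nNT iI; first by rewrite initial_cond// data_max_initial.
have n_lt : (n < NT)%N by exact: ltnW.
have [iO|iB] : i \in I_Omega N \/ i \in I_B N r.
  by apply/orP; rewrite -mem_cat.
  (* The Euler step raises u n i by at most 4 dt / h^2 <= 1 times its distance
     to the maximum of the data. *)
  have L_le : Lqnl gamma N r (u n) i <=
      4 / dx R N ^+ 2 * (data_max N r NT g q - u n i).
    by apply: Lqnl_le => // k kI; exact: IHn.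
  have u_le : u n i <= data_max N r NT g q by exact: IHn.
  have f_le := f_le0 _ _ (ltnW n_lt) iO.
  have := diffusion_eq _ _ n_lt iO => /(canRL (divfK (lt0r_neq0 dt_gt0))) step.
  rewrite -(subrK (u n i) (u n.+1 i)) -lerBrDr step mulrC.
  apply: (@le_trans _ _ (dt * (4 / dx R N ^+ 2 * (data_max N r NT g q - u n i)))).
    by rewrite ler_wpM2l ?(ltW dt_gt0)// -[leRHS]addr0 lerD.
  rewrite (_ : dt * _ = 4 * (dt / dx R N ^+ 2) * (data_max N r NT g q - u n i));
    last by ring.
  by rewrite ler_piMl ?subr_ge0//; lra.
by rewrite boundary_cond ?data_max_boundary// ltnW.
Qed.
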